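(* Let $(b_n)_{n\ge 1}$ be a sequence of positive integers and let $(A_n)_{n\ge1}$ be a sequence of sets with $\{0,1\}\subseteq A_n\subseteq\{0,1,\dots,b_n\}$ for every $n$. Consider the associated $(\{b_n\},\{A_n\},0)$-Sequence. Then every positive integer has a unique legal decomposition with respect to this sequence if and only if for every positive integer $n$ we have $$A_n\in\bigl\{\{0,1\},\ \{0,1,\dots,b_n-1\},\ \{0,1,\dots,b_n\}\bigr\}.$$
   Context: Given positive integers $b_n$ and sets $\{0,1\}\subseteq A_n\subseteq\{0,1,\dots,b_n\}$ ($n\ge 1$), the $(\{b_n\},\{A_n\},0)$-Sequence is a sequence of positive integers arranged consecutively in bins: the first $b_1$ terms form bin 1, the next $b_2$ terms form bin 2, and so on, so bin $n$ has length $b_n$. Given finitely or infinitely many terms arranged in bins in this way, a legal decomposition is a choice of finitely many of the terms such that for every $n$ the number of terms chosen from bin $n$ belongs to $A_n$; it is a decomposition of the integer equal to the sum of the chosen terms. (The ''$0$'' in the name is the adjacency number: there is no restriction relating choices from different bins.) Two legal decompositions are different if they are different choices of terms. The sequence is constructed recursively: the first term (the first element of bin 1) is $1$; once the first $k$ terms have been constructed, the next term (placed in the next available position, filling the bins in order) is the least positive integer that has no legal decomposition using only the first $k$ terms. *)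

(* Defs.v *)
From mathcomp Require Import all_boot finmap.
From mathcomp Require Import boolp.
Set Implicit Arguments. Unset Strict Implicit. Unset Printing Implicit Defensive.
Local Open Scope fset_scope.

(* Bins and positions are numbered from 0: [b n] and [A n] describe bin n+1 of
   the usual 1-based numbering, and [a k] is the (k+1)-st term of the sequence.
   A choice of terms is represented by the finite set of its positions; since 1 \in A n for
   all n, the terms of the sequence are pairwise distinct, so different sets of
   positions are different sets of terms. *)

Definition bin_start (b : nat -> nat) (n : nat) : nat := \sum_(i < n) b i.

Definition in_bin (b : nat -> nat) (n k : nat) : bool :=
  bin_start b n <= k < bin_start b n.+1.

Definition legal (b : nat -> nat) (A : nat -> {fset nat}) (S : {fset nat}) : Prop :=
  forall n, #|` [fset k in S | in_bin b n k]| \in A n.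

Definition legal_decomposition (b : nat -> nat) (A : nat -> {fset nat})
    (a : nat -> nat) (m : nat) (S : {fset nat}) : Prop :=
  legal b A S /\ \sum_(k <- S) a k = m.

Definition decomposable_by_first (b : nat -> nat) (A : nat -> {fset nat})
    (a : nat -> nat) (k m : nat) : Prop :=
  exists2 S : {fset nat},
    legal_decomposition b A a m S & forall i, i \in S -> i < k.

Definition least_positive (P : nat -> Prop) (m : nat) : Prop :=
  [/\ 0 < m, P m & forall m', 0 < m' -> P m' -> m <= m'].

Definition is_bin_sequence (b : nat -> nat) (A : nat -> {fset nat})
    (a : nat -> nat) : Prop :=
  a 0 = 1 /\
  forall k, least_positive
    (fun m => ~ decomposable_by_first b A a k.+1 m) (a k.+1).

(* The recursion determines exactly one sequence. *)

Lemma eq_decomposable_by_first b A a a' k m :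
  (forall i, i < k -> a i = a' i) ->
  decomposable_by_first b A a k m -> decomposable_by_first b A a' k m.
Proof.
move=> eq_a [S [lS sS] Sk]; exists S => //; split=> //.
by rewrite -sS; apply: eq_big_seq => i iS; rewrite eq_a // Sk.
Qed.

Lemma next_term_ex b A a k :
  exists m, least_positive (fun m => ~ decomposable_by_first b A a k m) m.
Proof.
pose P m := (0 < m) && `[< ~ decomposable_by_first b A a k m >].
have exP : exists m, P m.
  exists (\sum_(i <- [fset i in iota 0 k]) a i).+1; apply/asboolP.
  case=> S [_ sS] Sk.
  have SI : S `<=` [fset i in iota 0 k].
    by apply/fsubsetP => i iS; rewrite !inE mem_iota /= add0n Sk.
  have := leqnn (\sum_(i <- S) a i); rewrite {1}sS ltnNge => /negP; apply.
  by rewrite (big_fsetID _ (mem S) [fset i in iota 0 k]) /=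
    (_ : [fset x in [fset i in iota 0 k] | x \in S] = S) ?leq_addr //;
    apply/fsetP => i; rewrite !inE andb_idl // => /(fsubsetP SI); rewrite !inE.
case: (ex_minnP exP) => m /andP[m0 /asboolP mP] mmin.
by exists m; split=> // m' m'0 m'P; apply: mmin; rewrite /P m'0; apply/asboolP.
Qed.

Lemma bin_sequence_exists (b : nat -> nat) (A : nat -> {fset nat}) :
  exists a, is_bin_sequence b A a.
Proof.
have [F FP] := choice (fun s : seq nat => next_term_ex b A (nth 0 s) (size s)).
pose L := fix L k := if k is k'.+1 then rcons (L k') (F (L k')) else [:: 1].
have sL k : size (L k) = k.+1 by elim: k => //= k IH; rewrite size_rcons IH.
pose a k := nth 0 (L k) k.
have aL k i : i < k.+1 -> nth 0 (L k) i = a i.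
  elim: k => [|k IH]; first by case: i.
  rewrite ltnS leq_eqVlt => /orP[/eqP-> //|ik] /=.
  by rewrite nth_rcons sL ik IH.
exists a; split=> // k.
have -> : a k.+1 = F (L k) by rewrite /a /= nth_rcons sL ltnn eqxx.
have [m0 mP mmin] := FP (L k); rewrite sL in mP mmin.
split=> // [D|m' m'0 m'P]; first by apply/mP/(eq_decomposable_by_first _ D) => i /aL.
by apply: mmin => // D; apply/m'P/(eq_decomposable_by_first _ D) => i /aL.
Qed.

Lemma bin_sequence_unique (b : nat -> nat) (A : nat -> {fset nat}) a a' :
  is_bin_sequence b A a -> is_bin_sequence b A a' -> a =1 a'.
Proof.
move=> [a0 aP] [a'0 a'P]; elim/ltn_ind => -[|k] IH; first by rewrite a0 a'0.
have [p1 n1 l1] := aP k; have [p2 n2 l2] := a'P k.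
apply/eqP; rewrite eqn_leq l1 ?l2 // => D.
- by apply/n1/(eq_decomposable_by_first _ D) => i /IH.
- by apply/n2/(eq_decomposable_by_first _ D) => i /IH.
Qed.

(* Main.v *)
(** As long as all earlier bins are of the allowed kinds, their legal sums are
    exactly [0, ..., N - 1], each obtained once, where [N] is the first term of
    the current bin; so the terms of that bin are [N] times the terms of a
    one-bin sequence.  If [A n = {0, 1}] the bin is [N, 2N, 3N, ...], and if
    [A n] is [{0, ..., b n - 1}] or [{0, ..., b n}] it is [N, 2N, 4N, ...]; in all
    three cases the legal sums again form an initial segment without repetition.

    Conversely, let [t] be the least number missing from the first set [A n] not
    of these kinds.  If [3 <= t < b n], the bin starts with [N 2^i] for [i < t],
    then [N (2^t - 1)], and the following term is [N (3 2^(t-1) - 2)], which plus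
    [N] equals [N (2^t - 1) + N 2^(t-1)].  If [t = 2], let [s >= 3] be the next
    element of [A n]; then the terms are [N, 2N, ..., (s + 2)N].  When
    [b n >= s + 2], exchanging [1 + (s + 2)] and [2 + (s + 1)] in an [s]-element
    sum gives two decompositions.  When [b n] is [s] or [s + 1], unique
    decomposition makes the sums of the bins up to [n] and the sums of the later
    bins a tiling of the naturals, so by an argument of de Bruijn the former
    are a union of intervals [[q X, (q + 1) X)] with [X = N (b n + 1)]; the
    least sum above [X], namely [N s (s + 1) / 2], contradicts this. *)

Require Import Defs.
From mathcomp Require Import all_boot finmap zify.
Set Implicit Arguments. Unset Strict Implicit. Unset Printing Implicit Defensive.
Local Open Scope fset_scope.
Local Open Scope nat_scope.

(** * Tilings of the natural numbers by two sets *)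

(** Strong induction on [q], strengthened by a claim on [C]: it meets the block [[q X, (q + 1) X)]
    at most in its left end. For [q > 0], either the block is covered by sums whose [C]-summand is
    positive and lies below it, and then it meets neither set, or its left end is in [B] or in [C],
    which decides the rest of it. *)
Lemma tiling_blocks (B C : nat -> Prop) (X : nat) :
  (forall m, exists x y, [/\ B x, C y & x + y = m]) ->
  (forall x y x' y', B x -> C y -> B x' -> C y' -> x + y = x' + y' ->
     x = x' /\ y = y') ->
  0 < X -> (forall m, m < X -> B m) -> C X ->
  forall q r r', r < X -> r' < X -> B (q * X + r) -> B (q * X + r').
Proof.
move=> ex un X0 BX CX.
have B0 : B 0 by exact: BX.
have C0 : C 0 by have [[|x] [[|y] []]] := ex 0.
suff H q : (forall r r', r < X -> r' < X -> B (q * X + r) -> B (q * X + r')) /\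
           (forall r, r < X -> C (q * X + r) -> r = 0).
  by move=> q; have [] := H q.
elim/ltn_ind: q => -[|q] IH.
  split=> [r r' _ r'X _|r rX Cr]; first exact: BX.
  by have [|] := un 0 (0 * X + r) r 0 B0 Cr (BX _ rX) C0; lia.
set s := q.+1 in IH *.
(* By induction [y] is a multiple of [X] and [B] contains the whole block of [x]; sliding [x] along
   it reaches all of block [s]. *)
have step x y : B x -> C y -> 0 < y -> y < s * X -> s * X <= x + y < s.+1 * X ->
    forall r, r < X -> exists2 z, B z & z + y = s * X + r.
  move=> Bx Cy y0 ys xys r rX.
  have yE := divn_eq y X; have ym := ltn_pmod y X0.
  have ylt : y %/ X < s by rewrite ltn_divLR.
  rewrite yE in Cy; have y0X := (IH _ ylt).2 _ ym Cy; rewrite y0X addn0 in yE Cy.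
  have xE := divn_eq x X; have xm := ltn_pmod x X0.
  have yX : X <= y by case: (y %/ X) yE => [|k] E; rewrite ?mulSn in E; lia.
  have xlt : x %/ X < s by rewrite ltn_divLR // -(ltn_add2r X) -mulSnr; lia.
  have sE : x %/ X + y %/ X = s.
    have : s * X <= (x %/ X + y %/ X) * X + x %% X < s.+1 * X.
      by rewrite mulnDl; lia.
    move=> /andP[]; nia.
  exists (x %/ X * X + r); last by rewrite -sE mulnDl; lia.
  by apply: (IH _ xlt).1 xm rX _; rewrite -xE.
have [[x [y [Bx Cy y0 ys xys]]]|no] := boolp.pselect (exists x y,
    [/\ B x, C y, 0 < y, y < s * X & s * X <= x + y < s.+1 * X]).
  have {}step := step x y Bx Cy y0 ys xys.
  split=> [r r' rX _ Br|r rX Cr]; have [z Bz zE] := step r rX.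
    by have [] := un _ _ _ _ Bz Cy Br C0; lia.
  by have [] := un _ _ _ _ Bz Cy B0 Cr; lia.
(* In the remaining case the [C]-summand of an element of block [s] is zero or lies in block [s]
   itself. *)
have cover r : r < X -> B (s * X + r) \/
    exists2 r', r' <= r & C (s * X + r').
  move=> rX; have [x [y [Bx Cy xyE]]] := ex (s * X + r).
  have [y0|y0] := posnP y; first by left; rewrite -xyE y0 addn0.
  have [ys|ys] := ltnP y (s * X).
    by case: no; exists x, y; split=> //; rewrite xyE mulSn; lia.
  by right; exists (y - s * X); [lia|rewrite subnKC].
have [CsX|nCsX] := boolp.pselect (C (s * X)).
  split=> [r r' rX _ Br|r rX Cr].
    by have [] := un _ _ _ _ (BX _ rX) CsX Br C0; lia.
  by have [] := un _ _ _ _ (BX _ rX) CsX B0 Cr; lia.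
have BsX : B (s * X).
  have [|[r']] := cover 0 X0; first by rewrite addn0.
  by rewrite leqn0 => /eqP->; rewrite addn0.
have nC r : r < X -> C (s * X + r) -> r = 0.
  move=> rX Cr; have [//|r0] := posnP r.
  (* [s X + X] and [(X - r) + (s X + r)] are the same number. *)
  by have [] := un _ _ _ _ BsX CX (BX (X - r) _) Cr; nia.
split=> // r r' _ r'X _; have [//|[r2 r2r' Cr2]] := cover r' r'X.
have r20 : r2 = 0 by apply: nC Cr2; lia.
by move: Cr2; rewrite r20 addn0.
Qed.

(** [x] is a multiple of [N] below [N], hence zero. This strips the contribution of the earlier bins
    from a multiple of [N]. *)
Lemma mul_offset_inj N x u v : x < N -> N * u = x + N * v -> v = u.
Proof. nia. Qed.

(** * Intervals of positions *)

Definition block (p j : nat) : {fset nat} := [fset i in iota p j].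

Lemma in_block p j i : (i \in block p j) = (p <= i < p + j).
Proof. by rewrite !inE mem_iota. Qed.

Lemma sub_blockP (T : {fset nat}) p j :
  reflect (forall i, i \in T -> p <= i < p + j) (T `<=` block p j).
Proof.
by apply: (iffP (@fsubsetP _ _ _)) => H i iT; have := H i iT; rewrite in_block.
Qed.

Lemma block0 p : block p 0 = fset0.
Proof. by apply/fsetP => i; rewrite in_block !inE; lia. Qed.

Lemma blockS p j : block p j.+1 = (p + j) |` block p j.
Proof. by apply/fsetP => i; rewrite in_fset1U !in_block; lia. Qed.

Lemma card_block p j : #|` block p j| = j.
Proof.
elim: j => [|j IH]; first by rewrite block0 cardfs0.
by rewrite blockS cardfsU1 IH in_block; lia.
Qed.

Lemma sub_block_card (T : {fset nat}) p j : T `<=` block p j -> #|` T| <= j.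
Proof. by move=> /fsubset_leq_card; rewrite card_block. Qed.

Lemma sub_block_full (T : {fset nat}) p j :
  T `<=` block p j -> j <= #|` T| -> T = block p j.
Proof. by move=> sT jT; apply/eqP; rewrite eqEfcard sT card_block. Qed.

Lemma sub_blockW (T : {fset nat}) p j j' :
  j <= j' -> T `<=` block p j -> T `<=` block p j'.
Proof. by move=> jj' /sub_blockP sT; apply/sub_blockP => i /sT; lia. Qed.

Lemma sub_blockD1 (T : {fset nat}) p j :
  T `<=` block p j.+1 -> T `\ (p + j) `<=` block p j.
Proof.
by move=> /sub_blockP sT; apply/sub_blockP => i /fsetD1P[ij /sT]; lia.
Qed.

Lemma sub_blockU1 (T : {fset nat}) p j :
  T `<=` block p j -> (p + j) |` T `<=` block p j.+1.
Proof. by move=> sT; rewrite blockS fsetUS. Qed.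

Lemma sub_block_notin (T : {fset nat}) p j i :
  p + j <= i -> T `<=` block p j -> i \notin T.
Proof. by move=> ji /sub_blockP sT; apply/negP => /sT; lia. Qed.

(** * Weighted sums and exact families of sets *)

Definition wsum (w : nat -> nat) (S : {fset nat}) : nat := \sum_(i <- S) w i.

Lemma wsum0 w : wsum w fset0 = 0.
Proof. exact: big_seq_fset0. Qed.

Lemma wsum1 w x : wsum w [fset x] = w x.
Proof. exact: big_seq_fset1. Qed.

Lemma wsumU1 w x (T : {fset nat}) :
  x \notin T -> wsum w (x |` T) = w x + wsum w T.
Proof. exact: big_fsetU1. Qed.

Lemma wsumD1 w x (T : {fset nat}) :
  wsum w T = (x \in T) * w x + wsum w (T `\ x).
Proof.
have [xT|xT] := boolP (x \in T); first by rewrite /wsum (big_fsetD1 x) //= mul1n.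
by rewrite mem_fsetD1.
Qed.

Lemma eq_fsetD1 (T T' : {fset nat}) x :
  (x \in T) = (x \in T') -> T `\ x = T' `\ x -> T = T'.
Proof.
move=> xE /fsetP E; apply/fsetP => i.
by have := E i; rewrite !inE; case: eqP => [->|].
Qed.

(** The invariant carried from bin to bin: summing is a bijection from the [P]-sets onto [[0, X)].
    Keeping [P] and [w] arbitrary lets it serve both for legal sets with the terms [a] and for a
    single bin with its terms divided by [N]. *)
Definition exact (P : {fset nat} -> Prop) (w : nat -> nat) (X : nat) : Prop :=
  [/\ forall S, P S -> wsum w S < X,
      forall m, m < X -> exists2 S, P S & wsum w S = m &
      forall S S', P S -> P S' ->
        wsum w S = wsum w S' -> S = S'].

Lemma eq_exact (P P' : {fset nat} -> Prop) w X :
  (forall S, P S <-> P' S) -> exact P w X -> exact P' w X.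
Proof.
move=> PP' [lt ex un]; split=> [S /PP'/lt //|m /ex[S /PP'] PS sS|S S' /PP' + /PP'].
  by exists S.
exact: un.
Qed.

(** * Exact families inside a single bin *)

Definition pow2 (p i : nat) : nat := 2 ^ (i - p).

Lemma pow2E p j : pow2 p (p + j) = 2 ^ j.
Proof. by rewrite /pow2 addKn. Qed.

(** Binary expansion: the top position is used exactly when the sum reaches [2 ^ j]. *)
Lemma exact_pow2 p j :
  exact (fun T => T `<=` block p j) (pow2 p) (2 ^ j).
Proof.
elim: j => [|j [lt ex un]].
  split=> [T|m|T T']; rewrite ?block0.
  - by rewrite fsubset0 => /eqP ->; rewrite wsum0.
  - rewrite ltnS leqn0 => /eqP ->; exists fset0; rewrite ?fsub0set //.
    by rewrite wsum0.
  - by rewrite !fsubset0 => /eqP -> /eqP ->.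
have sE (T : {fset nat}) : wsum (pow2 p) T =
    (p + j \in T) * 2 ^ j + wsum (pow2 p) (T `\ (p + j)).
  by rewrite (wsumD1 _ (p + j)) pow2E.
split=> [T|m|T T'].
- move=> /sub_blockD1/lt; rewrite (sE T) expnS; case: (_ \in _) => /=; lia.
- rewrite expnS => mlt; have [mj|mj] := ltnP m (2 ^ j).
    by have [T sT TE] := ex m mj; exists T => //; apply: sub_blockW sT.
  have [|T sT TE] := ex (m - 2 ^ j); first lia.
  exists ((p + j) |` T); first exact: sub_blockU1.
  rewrite wsumU1 ?TE ?pow2E /=; first lia.
  exact: sub_block_notin sT.
- move=> /sub_blockD1 sT /sub_blockD1 sT'; rewrite (sE T) (sE T') => E.
  have l := lt _ sT; have l' := lt _ sT'.
  apply: (@eq_fsetD1 _ _ (p + j)); last apply: un => //.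
    by move: E; do 2 case: (_ \in _) => //=; lia.
  by move: E; do 2 case: (_ \in _) => //=; lia.
Qed.

Lemma sum_block_pow2 p j : wsum (pow2 p) (block p j) = (2 ^ j).-1.
Proof.
elim: j => [|j IH]; first by rewrite block0 wsum0.
rewrite blockS wsumU1 ?in_block ?pow2E /= ?IH ?expnS; last lia.
by have := expn_gt0 2 j; lia.
Qed.

(** Only the full block is lost, and it carries the largest sum. *)
Lemma exact_pow2_proper p j :
  exact (fun T => T `<=` block p j /\ #|` T| < j)
    (pow2 p) (2 ^ j).-1.
Proof.
have [lt ex un] := exact_pow2 p j.
have full (T : {fset nat}) : T `<=` block p j -> wsum (pow2 p) T = (2 ^ j).-1 ->
    T = block p j.
  by move=> sT TE; apply: un => //; rewrite sum_block_pow2.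
split=> [T [sT Tj]|m mlt|T T' [sT _] [sT' _]]; last exact: un.
- have := lt T sT; case: (eqVneq (wsum (pow2 p) T) (2 ^ j).-1); last lia.
  by move=> /(full _ sT) TE; rewrite TE card_block ltnn in Tj.
- have [|T sT TE] := ex m; first lia.
  exists T => //; split=> //; rewrite ltnNge; apply/negP => jT.
  by move: TE; rewrite (sub_block_full sT jT) sum_block_pow2; lia.
Qed.

Definition arith (p i : nat) : nat := (i - p).+1.

Lemma arithE p j : arith p (p + j) = j.+1.
Proof. by rewrite /arith addKn. Qed.

Lemma exact_singletons p j :
  exact (fun T => T `<=` block p j /\ #|` T| <= 1) (arith p) j.+1.
Proof.
have fam (T : {fset nat}) : T `<=` block p j /\ #|` T| <= 1 ->
    T = fset0 \/ exists2 i, i < j & T = [fset p + i].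
  case=> sT; rewrite leq_eqVlt ltnS leqn0 cardfs_eq0.
  case/orP => [/cardfs1P [i Ti]|/eqP ->]; last by left.
  have /(fsubsetP sT) : i \in T by rewrite Ti inE.
  by rewrite in_block => ij; right; exists (i - p); rewrite ?subnKC ?Ti //; lia.
have s1 i : wsum (arith p) ([fset p + i]) = i.+1.
  by rewrite wsum1 arithE.
split=> [T /fam[->|[i ij ->]]|[_|m mj]|T T' /fam FT /fam FT'].
- by rewrite wsum0.
- by rewrite s1.
- by exists fset0; rewrite ?fsub0set ?cardfs0 ?wsum0.
- exists [fset p + m]; rewrite ?s1 // cardfs1; split=> //.
  by apply/sub_blockP => i; rewrite inE => /eqP ->; lia.
- case: FT => [->|[i ij ->]]; case: FT' => [->|[i' ij' ->]] //;
    rewrite ?s1 ?wsum0 //.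
  by case=> ->.
Qed.

(** Distinct positive integers sum to at least [1 + 2 + ...] with as many summands. *)
Lemma sum_arith_ge p j (T : {fset nat}) :
  T `<=` block p j -> #|` T| * #|` T|.+1 <= 2 * wsum (arith p) T.
Proof.
elim: j T => [|j IH] T sT.
  by move: sT; rewrite block0 fsubset0 => /eqP ->; rewrite cardfs0.
have := IH _ (sub_blockD1 sT); have := sub_block_card (sub_blockD1 sT).
rewrite (wsumD1 _ (p + j) T) (cardfsD1 (p + j) T) arithE.
case: (_ \in _) => /=; nia.
Qed.

Lemma sum_block_arith p j : 2 * wsum (arith p) (block p j) = j * j.+1.
Proof.
elim: j => [|j IH]; first by rewrite block0 wsum0.
rewrite blockS wsumU1 /= ?in_block ?arithE ?mulnDr ?IH; lia.
Qed.

Lemma eq_wsum w w' (T : {fset nat}) :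
  (forall i, i \in T -> w i = w' i) -> wsum w T = wsum w' T.
Proof. by move=> E; apply: eq_big_seq. Qed.

Lemma wsum_scale N w (T : {fset nat}) :
  wsum (fun i => N * w i) T = N * wsum w T.
Proof. by rewrite /wsum big_distrr. Qed.

Lemma wsum_eq0 w (S : {fset nat}) :
  (forall i, 0 < w i) -> wsum w S = 0 -> S = fset0.
Proof.
move=> w0 S0; apply/fsetP => i; rewrite in_fset0; apply/negP => iS.
by have := wsumD1 w i S; rewrite iS S0; have := w0 i; lia.
Qed.

(** * Cutting a set at a position *)

Definition lower (q : nat) (S : {fset nat}) : {fset nat} := [fset k in S | k < q].
Definition upper (q : nat) (S : {fset nat}) : {fset nat} := [fset k in S | q <= k].

Lemma in_lower q S i : (i \in lower q S) = (i \in S) && (i < q).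
Proof. by rewrite !inE. Qed.

Lemma in_upper q S i : (i \in upper q S) = (i \in S) && (q <= i).
Proof. by rewrite !inE. Qed.

Lemma lowerU q (S T : {fset nat}) :
  (forall i, i \in S -> i < q) -> (forall i, i \in T -> q <= i) ->
  lower q (S `|` T) = S.
Proof.
move=> Sq Tq; apply/fsetP => i; rewrite in_lower in_fsetU.
have [/Sq -> //|_] := boolP (i \in S).
by have [/Tq|//] := boolP (i \in T); rewrite /= leqNgt => /negbTE.
Qed.

Lemma upperU q (S T : {fset nat}) :
  (forall i, i \in S -> i < q) -> (forall i, i \in T -> q <= i) ->
  upper q (S `|` T) = T.
Proof.
move=> Sq Tq; apply/fsetP => i; rewrite in_upper in_fsetU.
have [/Tq ->|_] := boolP (i \in T); first by rewrite orbT.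
by have [/Sq|//] := boolP (i \in S); rewrite /= ltnNge => /negbTE.
Qed.

Lemma lower_upperU q (S : {fset nat}) : lower q S `|` upper q S = S.
Proof.
by apply/fsetP => i; rewrite in_fsetU in_lower in_upper; case: (i \in S) => //=; lia.
Qed.

Lemma wsum_lower_upper w q (S : {fset nat}) :
  wsum w S = wsum w (lower q S) + wsum w (upper q S).
Proof.
rewrite /wsum (big_fsetID _ (fun k => k < q)) /=; congr (_ + _).
by apply: eq_fbigl => i; rewrite !inE -leqNgt.
Qed.

Lemma wsumU w q (S T : {fset nat}) :
  (forall i, i \in S -> i < q) -> (forall i, i \in T -> q <= i) ->
  wsum w (S `|` T) = wsum w S + wsum w T.
Proof.
by move=> Sq Tq; rewrite (wsum_lower_upper _ q) lowerU // upperU.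
Qed.

(** * Legal sets, bin by bin *)

Section BinSequence.

Variables (b : nat -> nat) (A : nat -> {fset nat}) (a : nat -> nat).
Hypothesis b_gt0 : forall n, 0 < b n.
Hypothesis A_ge : forall n, [fset 0; 1] `<=` A n.
Hypothesis A_le : forall n, A n `<=` [fset k in iota 0 (b n).+1].
Hypothesis a_seq : is_bin_sequence b A a.

Local Notation start := (bin_start b).
Local Notation decomposable := (decomposable_by_first b A a).

Lemma A0 n : 0 \in A n.
Proof. by apply: (fsubsetP (A_ge n)); rewrite !inE. Qed.

Lemma A1 n : 1 \in A n.
Proof. by apply: (fsubsetP (A_ge n)); rewrite !inE. Qed.

Lemma A_bound n k : k \in A n -> k <= b n.
Proof. by move=> /(fsubsetP (A_le n)); rewrite !inE mem_iota; lia. Qed.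

Lemma term_gt0 k : 0 < a k.
Proof. by case: a_seq => a0 aS; case: k => [|k]; rewrite ?a0 //; case: (aS k). Qed.

Lemma startS n : start n.+1 = start n + b n.
Proof. by rewrite /bin_start big_ord_recr. Qed.

Lemma start_le m n : m <= n -> start m <= start n.
Proof.
move=> mn; rewrite -(subnKC mn); elim: (n - m) => [|d IH]; first by rewrite addn0.
by rewrite addnS startS; lia.
Qed.

Lemma start_ge n : n <= start n.
Proof. by elim: n => // n IH; rewrite startS; have := b_gt0 n; lia. Qed.

Lemma in_bin_inj m n k : in_bin b m k -> in_bin b n k -> m = n.
Proof.
rewrite /in_bin => km kn; case: (ltngtP m n) => // /start_le; lia.
Qed.

Definition bin_part n (S : {fset nat}) := [fset k in S | in_bin b n k].

Lemma bin_part0 n (S : {fset nat}) :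
  (forall i, i \in S -> ~~ in_bin b n i) -> bin_part n S = fset0.
Proof.
move=> H; apply/fsetP => i; rewrite !inE; apply/negP => /= /andP[iS iB].
by move: (H i iS); rewrite iB.
Qed.

Lemma eq_bin_part n (S T : {fset nat}) :
  (forall i, in_bin b n i -> (i \in S) = (i \in T)) -> bin_part n S = bin_part n T.
Proof.
move=> H; apply/fsetP => i; rewrite !inE /=.
by case: (boolP (in_bin b n i)) => [/H ->|]; rewrite ?andbF.
Qed.

(** A cut at a bin start splits no bin: each bin keeps all its chosen positions or none, and 0 is
    always an allowed number. *)
Lemma legal_lower n S : legal b A S -> legal b A (lower (start n) S).
Proof.
move=> lS m; rewrite -/(bin_part _ _); case: (ltnP m n) => mn.
  rewrite (@eq_bin_part _ _ S) ?lS // => i iB; rewrite in_lower.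
  by move: (start_le mn) iB; rewrite /in_bin; case: (_ \in _) => //=; lia.
rewrite bin_part0 ?cardfs0 ?A0 // => i; rewrite in_lower /in_bin.
by have := start_le mn; lia.
Qed.

Lemma legal_upper n S : legal b A S -> legal b A (upper (start n) S).
Proof.
move=> lS m; rewrite -/(bin_part _ _); case: (ltnP m n) => mn.
  rewrite bin_part0 ?cardfs0 ?A0 // => i; rewrite in_upper /in_bin.
  by have := start_le mn; lia.
rewrite (@eq_bin_part _ _ S) ?lS // => i iB; rewrite in_upper.
by move: (start_le mn) iB; rewrite /in_bin; case: (_ \in _) => //=; lia.
Qed.

Lemma legalU n (S T : {fset nat}) :
  legal b A S -> legal b A T ->
  (forall i, i \in S -> i < start n) -> (forall i, i \in T -> start n <= i) ->
  legal b A (S `|` T).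
Proof.
move=> lS lT Sn Tn m; rewrite -/(bin_part _ _); case: (ltnP m n) => mn.
  rewrite (@eq_bin_part _ _ S) ?lS // => i iB; rewrite in_fsetU orbC.
  case: (boolP (i \in T)) => //= /Tn; move: (start_le mn) iB.
  by rewrite /in_bin; lia.
rewrite (@eq_bin_part _ _ T) ?lT // => i iB; rewrite in_fsetU.
case: (boolP (i \in S)) => //= /Sn; move: (start_le mn) iB.
by rewrite /in_bin; lia.
Qed.

Lemma legal_bin n (T : {fset nat}) :
  T `<=` block (start n) (b n) -> (legal b A T <-> #|` T| \in A n).
Proof.
move=> /sub_blockP sT; have TB i : i \in T -> in_bin b n i.
  by move=> /sT; rewrite /in_bin startS.
have TE : bin_part n T = T.
  by apply/fsetP => i; rewrite !inE /= andb_idr // => /TB.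
split=> [/(_ n)|An m]; rewrite -/(bin_part _ _) ?TE //.
have [-> //|mn] := eqVneq m n; first by rewrite TE.
rewrite bin_part0 ?cardfs0 ?A0 // => i /TB iB; apply/negP => iB'.
by rewrite (in_bin_inj iB' iB) eqxx in mn.
Qed.

Lemma legal0 : legal b A fset0.
Proof. by move=> n; rewrite -/(bin_part _ _) bin_part0 ?cardfs0 ?A0. Qed.

Definition legal_upto (k : nat) (S : {fset nat}) : Prop :=
  legal b A S /\ forall i, i \in S -> i < k.

Lemma decomposableP k m :
  decomposable k m <-> exists2 S, legal_upto k S & wsum a S = m.
Proof.
by split=> [[S [lS sS] Sk]|[S [lS Sk] sS]]; exists S.
Qed.

Lemma legal_upto_binP n j (S : {fset nat}) : j <= b n ->
  (legal_upto (start n + j) S <->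
   exists S1 T, [/\ legal_upto (start n) S1, T `<=` block (start n) j,
                    #|` T| \in A n & S = S1 `|` T]).
Proof.
move=> jb; split=> [[lS Sk]|[S1 [T [[lS1 S1n] sT cT ->]]]].
  have sT : upper (start n) S `<=` block (start n) j.
    by apply/sub_blockP => i; rewrite in_upper => /andP[/Sk]; lia.
  exists (lower (start n) S), (upper (start n) S); split=> //.
  - by split=> [|i]; [exact: legal_lower|rewrite in_lower => /andP[]].
  - apply/(legal_bin (sub_blockW jb sT)); exact: legal_upper.
  - by rewrite lower_upperU.
have lT : legal b A T by apply/(legal_bin (sub_blockW jb sT)).
move/sub_blockP in sT; split=> [|i].
  by apply: (legalU lS1 lT S1n) => i /sT; lia.
by rewrite in_fsetU => /orP[/S1n|/sT]; lia.
Qed.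

Lemma wsum_binU n j (S T : {fset nat}) :
  legal_upto (start n) S -> T `<=` block (start n) j ->
  wsum a (S `|` T) = wsum a S + wsum a T.
Proof.
by move=> [_ Sn] /sub_blockP sT; apply: (@wsumU _ (start n)) => // i /sT; lia.
Qed.

Lemma next_term k X :
  0 < X -> ~ decomposable k.+1 X -> (forall m, m < X -> decomposable k.+1 m) ->
  a k.+1 = X.
Proof.
move=> X0 nX ltX; have [_ /(_ k) [a0 na la]] := a_seq.
apply/eqP; rewrite eqn_leq la //= leqNgt; apply/negP => /ltX; exact: na.
Qed.

(** [X] is the least number that the first [k] terms miss, so the recursion picks it. For [k = 0]
    only the empty set is available, which forces [X = 1]. *)
Lemma next_term_exact k X : exact (legal_upto k) a X -> a k = X.
Proof.
move=> [lt ex _]; case: k lt ex => [|k] lt ex.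
  have [-> _] := a_seq.
  have X0 : 0 < X by have := lt fset0; rewrite wsum0; apply; split=> //; exact: legal0.
  suff : ~ (1 < X) by lia.
  move=> /ex[S [_ SS]]; have -> : S = fset0; last by rewrite wsum0.
  by apply/fsetP => i; rewrite in_fset0; apply/negP => /SS.
apply: next_term.
- by have := lt fset0; rewrite wsum0; apply; split=> //; exact: legal0.
- by move=> /decomposableP[S /lt + SE]; rewrite SE ltnn.
- by move=> m /ex[S lS SE]; apply/decomposableP; exists S.
Qed.

(** * One bin above an exact initial segment *)

Section Bin.

Variables n N : nat.
Hypothesis exactN : exact (legal_upto (start n)) a N.

Local Notation p := (start n).

Lemma bin_unit_gt0 : 0 < N.
Proof. by rewrite -(next_term_exact exactN) term_gt0. Qed.

Lemma wsum_bin w j (T : {fset nat}) :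
  (forall i, i < j -> a (p + i) = N * w (p + i)) -> T `<=` block p j ->
  wsum a T = N * wsum w T.
Proof.
move=> aw /sub_blockP sT; rewrite -wsum_scale; apply: eq_wsum => i /sT ip.
by rewrite -(@subnKC p i) ?aw; lia.
Qed.

Lemma decomposable_binP w j m :
  j <= b n -> (forall i, i < j -> a (p + i) = N * w (p + i)) ->
  (decomposable (p + j) m <->
   exists x T, [/\ x < N, T `<=` block p j, #|` T| \in A n &
                   m = x + N * wsum w T]).
Proof.
move=> jb aw; have [lt ex _] := exactN; split.
  move=> /decomposableP[S /(legal_upto_binP _ jb)[S1 [T [uS1 sT cT ->]]] <-].
  exists (wsum a S1), T; split=> //; first exact: lt.
  by rewrite (wsum_binU uS1 sT) (wsum_bin aw sT).
move=> [x [T [/ex[S1 uS1 <-] sT cT ->]]]; apply/decomposableP.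
exists (S1 `|` T); first by apply/legal_upto_binP => //; exists S1, T.
by rewrite (wsum_binU uS1 sT) (wsum_bin aw sT).
Qed.

(** Euclidean division by [N]: the earlier bins supply the remainder and bin [n] the quotient, each
    in exactly one way. *)
Lemma exact_bin w j Y :
  j <= b n -> (forall i, i < j -> a (p + i) = N * w (p + i)) ->
  exact (fun T => T `<=` block p j /\ #|` T| \in A n) w Y ->
  exact (legal_upto (p + j)) a (N * Y).
Proof.
move=> jb aw [ltw exw unw]; have [lt ex un] := exactN; have N0 := bin_unit_gt0.
split=> [S|m mY|S S'].
- move=> /(legal_upto_binP _ jb)[S1 [T [uS1 sT cT ->]]].
  rewrite (wsum_binU uS1 sT) (wsum_bin aw sT).
  have := lt _ uS1; have := ltw T (conj sT cT); nia.
- have [|T [sT cT] TE] := exw (m %/ N); first by rewrite ltn_divLR // mulnC.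
  apply/decomposableP/(decomposable_binP _ jb aw).
  exists (m %% N), T; split=> //; first exact: ltn_pmod.
  by rewrite TE {1}(divn_eq m N) addnC mulnC.
- move=> /(legal_upto_binP _ jb)[S1 [T [uS1 sT cT ->]]].
  move=> /(legal_upto_binP _ jb)[S1' [T' [uS1' sT' cT' ->]]].
  rewrite (wsum_binU uS1 sT) (wsum_bin aw sT).
  rewrite (wsum_binU uS1' sT') (wsum_bin aw sT') => E.
  have l := lt _ uS1; have l' := lt _ uS1'.
  have ET : wsum w T = wsum w T'.
    have := congr1 (divn^~ N) E; rewrite !(addnC (wsum a _)) !(mulnC N).
    by rewrite !divnMDl // !divn_small // !addn0.
  have ES : wsum a S1 = wsum a S1' by move: E; rewrite ET => /addIn.
  by rewrite (un S1 S1') // (unw T T').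
Qed.

(** Exactness at the shorter lengths yields the terms [N * 2 ^ i] through [next_term_exact], and
    these terms yield exactness at length [j]. No subset is excluded, as all sizes up to [j] are
    allowed. *)
Lemma exact_geometric t j :
  (forall k, k < t -> k \in A n) -> j < t -> j <= b n ->
  exact (legal_upto (p + j)) a (N * 2 ^ j).
Proof.
move=> tA; elim/ltn_ind: j => j IH jt jb; apply: (exact_bin (w := pow2 p)) => //.
  by move=> i ij; rewrite pow2E; apply/next_term_exact/IH; lia.
apply: eq_exact (exact_pow2 p j) => T; split=> [sT|[]//]; split=> //.
by apply: tA; have := sub_block_card sT; lia.
Qed.

(** Among the subsets of the first [t] positions, the forbidden size [t] excludes only the full
    block. *)
Lemma exact_geometric_proper t :
  (forall k, k < t -> k \in A n) -> t \notin A n -> t <= b n ->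
  exact (legal_upto (p + t)) a (N * (2 ^ t).-1).
Proof.
move=> tA nt tb; apply: (exact_bin (w := pow2 p)) => //.
  by move=> i ij; rewrite pow2E; apply/next_term_exact/exact_geometric; [exact: tA|lia..].
apply: eq_exact (exact_pow2_proper p t) => T; split=> -[sT cT]; split=> //.
  exact: tA.
rewrite ltn_neqAle (sub_block_card sT) andbT.
by apply: contraNneq nt => <-.
Qed.

Lemma exact_arithmetic j :
  (forall k, k \in A n -> k <= 1) -> j <= b n ->
  exact (legal_upto (p + j)) a (N * j.+1).
Proof.
move=> Ak; elim/ltn_ind: j => j IH jb; apply: (exact_bin (w := arith p)) => //.
  by move=> i ij; rewrite arithE; apply/next_term_exact/IH; lia.
apply: eq_exact (exact_singletons p j) => T; split=> -[sT cT]; split=> //.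
  by case: #|` T| cT => [|[|//]] _; rewrite ?A0 ?A1.
exact: Ak.
Qed.

Lemma exact_next_bin :
  [\/ A n = [fset 0; 1],
      A n = [fset k in iota 0 (b n)]
    | A n = [fset k in iota 0 (b n).+1]] ->
  exact (legal_upto (start n.+1)) a (a (start n.+1)).
Proof.
suff H : [\/ A n = [fset 0; 1], A n = [fset k in iota 0 (b n)]
    | A n = [fset k in iota 0 (b n).+1]] ->
    exists X, exact (legal_upto (start n.+1)) a X.
  by move=> /H[X eX]; rewrite (next_term_exact eX).
rewrite startS => -[] AE.
- exists (N * (b n).+1); apply: exact_arithmetic => // k.
  by rewrite AE !inE => /orP[] /eqP ->.
- exists (N * (2 ^ b n).-1); apply: exact_geometric_proper => //.
    by move=> k kb; rewrite AE !inE mem_iota.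
  by rewrite AE !inE mem_iota /= ltnn.
- exists (N * 2 ^ b n); apply: (@exact_geometric (b n).+1) => //.
  by move=> k kb; rewrite AE !inE mem_iota; lia.
Qed.

(** * Necessity: a least missing size [t] with [3 <= t < b n] *)

Hypothesis uniq : forall S S', legal b A S -> legal b A S' ->
  wsum a S = wsum a S' -> S = S'.

Lemma initial_run_le2 t :
  (forall k, k < t -> k \in A n) -> t \notin A n -> 2 < t -> t < b n -> False.
Proof.
case: t => [//|u] tA ntA u2 ub; set t := u.+1 in tA ntA ub *.
have N0 := bin_unit_gt0.
have P4 : 4 <= 2 ^ u by rewrite (@leq_pexp2l 2 2 u).
have PE : 2 ^ t = 2 * 2 ^ u by rewrite expnS.
set P := 2 ^ u in P4 PE *.
have tlast : p + t \notin block p t by rewrite in_block; lia.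
have ai i : i < t -> a (p + i) = N * 2 ^ i.
  by move=> it; apply: next_term_exact; apply: (exact_geometric tA); lia.
have at_ : a (p + t) = N * (2 ^ t).-1.
  by apply: next_term_exact; apply: (exact_geometric_proper tA ntA); lia.
pose w i := if i == p + t then (2 ^ t).-1 else pow2 p i.
have aw i : i < t.+1 -> a (p + i) = N * w (p + i).
  rewrite ltnS leq_eqVlt => /orP[/eqP ->|it]; first by rewrite /w eqxx at_.
  by rewrite /w ifN ?pow2E ?ai //; lia.
have wt : w (p + t) = (2 ^ t).-1 by rewrite /w eqxx.
have wE T : T `<=` block p t -> wsum w T = wsum (pow2 p) T.
  move=> /sub_blockP sT; apply: eq_wsum => i /sT ip; rewrite /w ifN //; lia.
have [ltp exp_ unp] := exact_pow2 p t.
have [ltq exq _] := exact_pow2_proper p t.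
have [ltr exr _] := exact_pow2_proper p u.
have tb : t.+1 <= b n by [].
(* The excess [3P - 2 - (2^t - 1) = 2^u - 1] forces the whole of [block p u],
   which together with [p + t] has the forbidden size [t]. *)
have next : a (p + t).+1 = N * (3 * P - 2).
  apply: next_term; rewrite -?addnS; first nia.
  - move=> /(decomposable_binP _ tb aw)[x [T [xN sT cT E]]].
    have {}E := (mul_offset_inj xN E).
    have sT' := sub_blockD1 sT.
    move: cT E; rewrite (cardfsD1 (p + t)) (wsumD1 _ (p + t)) (wE _ sT') wt.
    case: (_ \in T) => /= cT E.
      have TE : T `\ (p + t) = block p u.
        apply: unp; rewrite ?sum_block_pow2 //; last by rewrite -/P; lia.
        exact: sub_blockW (fsubset_refl _).
      by move: cT; rewrite TE card_block add1n (negbTE ntA).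
    have ct : #|` T `\ (p + t)| < t.
      rewrite ltn_neqAle (sub_block_card sT') andbT.
      by apply: contraNneq ntA => <-.
    by have := ltq _ (conj sT' ct); lia.
  - move=> m mlt; apply/(decomposable_binP _ tb aw).
    have yE := divn_eq m N; have xN := ltn_pmod m N0.
    have ylt : m %/ N < 3 * P - 2 by rewrite ltn_divLR // mulnC.
    have [yl|yl] := ltnP (m %/ N) (2 ^ t).-1.
      have [T [sT cT] TE] := exq _ yl.
      exists (m %% N), T; split=> //; first exact: sub_blockW sT.
        exact: tA.
      by rewrite wE // TE mulnC; lia.
    have [|T [sT cT] TE] := exr (m %/ N - (2 ^ t).-1); first by rewrite -/P; lia.
    have sTt : T `<=` block p t by exact: sub_blockW sT.
    have nT : p + t \notin T by exact: sub_block_notin sTt.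
    exists (m %% N), ((p + t) |` T); split=> //.
    - exact: sub_blockU1.
    - by apply: tA; rewrite cardfsU1 nT; lia.
    - by rewrite wsumU1 // wt wE // TE subnKC // mulnC; lia.
have l1 : legal b A [fset p + u; p + t].
  apply/(@legal_bin n).
    by apply/sub_blockP => i; rewrite !inE => /orP[] /eqP ->; lia.
  by rewrite cardfs2 tA //; lia.
have l2 : legal b A [fset p; (p + t).+1].
  (* If [b n = t + 1], the second position opens the next bin, and the set takes one term from each
     of two bins. *)
  have [tb2|tb2] := ltnP t.+1 (b n).
    apply/(@legal_bin n).
      by apply/sub_blockP => i; rewrite !inE => /orP[] /eqP ->; lia.
    by rewrite cardfs2 tA //; lia.
  have sE : start n.+1 = (p + t).+1 by rewrite startS; lia.
  apply: (@legalU n.+1); rewrite ?sE.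
  - apply/(@legal_bin n); rewrite ?cardfs1 ?A1 //.
    by apply/sub_blockP => i; rewrite !inE => /eqP ->; lia.
  - apply/(@legal_bin n.+1); rewrite ?cardfs1 ?A1 //.
    apply/sub_blockP => i; rewrite !inE => /eqP ->; rewrite sE.
    by have := b_gt0 n.+1; lia.
  - by move=> i; rewrite inE => /eqP ->; lia.
  - by move=> i; rewrite inE => /eqP ->; lia.
(* Both sums equal [N (3 P - 1)], but only the second set contains [p]. *)
have := uniq l1 l2; rewrite !wsumU1 ?inE ?wsum1; [|lia..].
have ap : a p = N by have := ai 0; rewrite addn0 muln1; apply.
rewrite at_ next (ai u) // -/P ap => E.
have : p \in [fset p + u; p + t] by rewrite E ?inE ?eqxx //; nia.
by rewrite !inE; lia.
Qed.

(** * Necessity: a gap in [A n] between 1 and [s] *)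

Section Gap.

Variable s : nat.
Hypothesis s_ge3 : 2 < s.
Hypothesis sA : s \in A n.
Hypothesis gapA : forall k, 1 < k < s -> k \notin A n.

Lemma gap_card k : k \in A n -> k <= 1 \/ s <= k.
Proof.
move=> kA; case: (leqP k 1) => k1; [by left|right].
by rewrite leqNgt; apply/negP => ks; move: kA; apply/negP/gapA; rewrite k1.
Qed.

Lemma gap_wsum j (T : {fset nat}) :
  T `<=` block p j -> #|` T| \in A n ->
  wsum (arith p) T <= j \/ (s <= #|` T| /\ s * s.+1 <= 2 * wsum (arith p) T).
Proof.
move=> sT /gap_card[c1|cs].
  by left; have [lt _ _] := exact_singletons p j; have := lt T (conj sT c1); lia.
by right; split=> //; have := sum_arith_ge sT; nia.
Qed.

(** At least [s] positions have weight at least [s (s + 1) / 2], which exceeds [s + 2]; so only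
    single terms matter in this range. The case [j = b n] gives the first term of the next bin. *)
Lemma gap_terms j : j <= s.+1 -> j <= b n -> a (p + j) = N * j.+1.
Proof.
have N0 := bin_unit_gt0.
elim/ltn_ind: j => -[|j] IH js jb.
  by rewrite addn0 muln1; apply: next_term_exact.
have aw i : i < j.+1 -> a (p + i) = N * arith p (p + i).
  by move=> ij; rewrite arithE IH //; lia.
rewrite addnS; apply: next_term; rewrite -?addnS; first by rewrite muln_gt0 N0.
- move=> /(decomposable_binP _ jb aw)[x [T [xN sT cT E]]].
  have {}E := mul_offset_inj xN E.
  by case: (gap_wsum sT cT); rewrite E; nia.
- move=> m mlt; apply/(decomposable_binP _ jb aw).
  have [_ ex _] := exact_singletons p j.+1.
  have [|T [sT cT] TE] := ex (m %/ N); first by rewrite ltn_divLR // mulnC.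
  exists (m %% N), T; split=> //; first exact: ltn_pmod.
    by case: #|` T| cT => [|[|//]] _; rewrite ?A0 ?A1.
  by rewrite TE {1}(divn_eq m N) addnC mulnC.
Qed.

Lemma gap_bin_short : b n <= s.+1.
Proof.
rewrite leqNgt; apply/negP => sb.
(* The part common to both sets; it avoids [p], [p + 1], [p + s] and [p + s + 1], whose weights
   satisfy [1 + (s + 2) = 2 + (s + 1)]. *)
pose R := block p.+2 (s - 2).
have nR i : (i < p + 2) || (p + s <= i) -> i \notin R by rewrite in_block; lia.
have RS : R `<=` block p (b n).
  by apply/sub_blockP => i; rewrite in_block; lia.
have cR : #|` R| = s - 2 by rewrite card_block.
have leg x y : x != y -> x \notin R -> y \notin R -> x \in block p (b n) ->
    y \in block p (b n) -> legal b A (x |` (y |` R)).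
  move=> xy xR yR xB yB; apply/(@legal_bin n).
    by rewrite !fsubUset !fsub1set xB yB.
  rewrite !cardfsU1 in_fset1U negb_or xy xR yR cR /= (_ : 1 + (1 + (s - 2)) = s) //.
  lia.
have l1 : legal b A (p |` ((p + s.+1) |` R)).
  by apply: leg; rewrite ?nR ?in_block; lia.
have l2 : legal b A ((p + 1) |` ((p + s) |` R)).
  by apply: leg; rewrite ?nR ?in_block; lia.
have := uniq l1 l2.
have ap : a p = N by have := @gap_terms 0; rewrite addn0 muln1; apply.
rewrite !wsumU1 ?in_fset1U ?negb_or ?nR; [|lia..].
rewrite ap !gap_terms; [|lia..] => E.
have : p \in (p + 1) |` ((p + s) |` R) by rewrite -E ?in_fset1U ?eqxx //; nia.
by rewrite !in_fset1U (negbTE (nR _ _)); lia.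
Qed.

Hypothesis legal_ex : forall m, exists2 S, legal b A S & wsum a S = m.

Lemma gap_absurd : False.
Proof.
have N0 := bin_unit_gt0.
have sb : s <= b n by exact: A_bound sA.
have bs := gap_bin_short.
have aw i : i < b n -> a (p + i) = N * arith p (p + i).
  by move=> ib; rewrite arithE gap_terms //; lia.
set X := N * (b n).+1.
have aX : a (p + b n) = X by rewrite gap_terms.
have X0 : 0 < X by rewrite muln_gt0 N0.
pose B := decomposable (p + b n).
pose C m := exists S, [/\ legal b A S, forall i, i \in S -> start n.+1 <= i &
                        wsum a S = m].
have BP m : B m <-> exists x T, [/\ x < N, T `<=` block p (b n), #|` T| \in A n &
                   m = x + N * wsum (arith p) T].
  exact: decomposable_binP.
(* [X] is the term at [p + b n], hence the least positive number that the terms before it do not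
   decompose. *)
have BX m : m < X -> B m.
  move=> mX; apply: boolp.contrapT => nB.
  have [_ /(_ (p + b n).-1)] := a_seq.
  have -> : (p + b n).-1.+1 = p + b n by have := b_gt0 n; lia.
  rewrite aX => -[_ nX lX]; have [m0|m0] := posnP m; last first.
    by have := lX m m0 nB; lia.
  apply: nB; rewrite m0; apply/BP; exists 0, fset0; split=> //.
  - by rewrite cardfs0 A0.
  - by rewrite wsum0 muln0.
have ex m : exists x y, [/\ B x, C y & x + y = m].
  have [S lS <-] := legal_ex m.
  exists (wsum a (lower (start n.+1) S)), (wsum a (upper (start n.+1) S)).
  split; last by rewrite -wsum_lower_upper.
    apply/decomposableP; exists (lower (start n.+1) S) => //; split.
      exact: legal_lower.
    by move=> i; rewrite in_lower startS => /andP[].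
  exists (upper (start n.+1) S); split=> //; first exact: legal_upper.
  by move=> i; rewrite in_upper => /andP[].
have un x y x' y' : B x -> C y -> B x' -> C y' -> x + y = x' + y' ->
    x = x' /\ y = y'.
  rewrite /B -startS => /decomposableP[S [lS Sn] <-] [T [lT Tn <-]].
  move=> /decomposableP[S' [lS' Sn'] <-] [T' [lT' Tn' <-]].
  rewrite -!(@wsumU _ (start n.+1)) // => /uniq E.
  have {}E : S `|` T = S' `|` T' by apply: E; apply: (@legalU n.+1).
  split.
    by rewrite -(lowerU Sn Tn) E lowerU.
  by rewrite -(upperU Sn Tn) E upperU.
have CX : C X.
  exists [fset start n.+1]; split.
  - apply/(@legal_bin n.+1); rewrite ?cardfs1 ?A1 //.
    apply/sub_blockP => i; rewrite !inE => /eqP ->.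
    by have := b_gt0 n.+1; lia.
  - by move=> i; rewrite inE => /eqP ->.
  - by rewrite wsum1 startS.
have tile := tiling_blocks ex un X0 BX CX.
have VE := sum_block_arith p s; set V := wsum _ _ in VE.
have bV : b n < V by nia.
have BV : B (N * V).
  apply/BP; exists 0, (block p s); split=> //; last by rewrite card_block.
  exact: sub_blockW (fsubset_refl _).
have vE := divn_eq (N * V) X; have rX := ltn_pmod (N * V) X0.
have VX : X <= N * V by rewrite leq_mul2l bV orbT.
have q0 : 0 < N * V %/ X by rewrite divn_gt0.
set q := N * V %/ X in vE q0; set r := N * V %% X in vE rX.
(* Tiling puts [q X] in [B]. Being at least [X], it is out of reach with at most one term of bin
   [n], so it needs [s] or more and is at least [N V]. Since [N V = q X + r], this forces
   [r = 0]. *)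
rewrite vE in BV; have := tile q r 0 rX X0 BV; rewrite addn0.
move=> /BP[x [T [xN sT cT E]]].
have VT : V <= wsum (arith p) T.
  by case: (gap_wsum sT cT) => [Tb|[_]]; [rewrite /X in E; nia|lia].
have NVT : N * V <= N * wsum (arith p) T by rewrite leq_mul2l VT orbT.
have qV : q * (b n).+1 = V.
  have : N * (q * (b n).+1) = N * V by rewrite mulnCA -/X; lia.
  by move/eqP; rewrite eqn_mul2l => /orP[|/eqP//]; lia.
have r0 : r = 0 by move: vE; rewrite -qV mulnCA -/X; lia.
have [bE|bE] : b n = s.+1 \/ b n = s by lia.
  (* Here [s + 2] divides [2 V = s (s + 1) = (s + 2) (s - 1) + 2]. *)
  have : s.+2 %| 2.
    rewrite -(@dvdn_addr (s.+2 * s.-1)) ?dvdn_mulr //.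
    have -> : s.+2 * s.-1 + 2 = q * 2 * s.+2 by rewrite bE in qV; nia.
    exact: dvdn_mull.
  by move=> /dvdn_leq; lia.
(* Here [b n = s], so the full bin is the only choice of [s] or more positions. Its weight is [V],
   yet tiling also puts [N (V + 1)] in [B]. *)
have NX : N < X by rewrite ltn_Pmulr // ltnS b_gt0.
have := tile q r N rX NX BV => /BP[x' [T' [x'N sT' cT' E']]].
have T'E : wsum (arith p) T' = V.+1.
  by apply: (mul_offset_inj x'N); rewrite mulnS; lia.
case: (gap_wsum sT' cT') => [|[cs _]]; first lia.
rewrite bE in sT'; have := T'E; rewrite (sub_block_full sT' cs) -/V; lia.
Qed.

End Gap.

End Bin.

End BinSequence.

(** * Assembling both directions *)

Theorem theorem1p1 (b : nat -> nat) (A : nat -> {fset nat}) (a : nat -> nat)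
    (b_gt0 : forall n, 0 < b n)
    (A_ge : forall n, [fset 0; 1] `<=` A n)
    (A_le : forall n, A n `<=` [fset k in iota 0 (b n).+1])
    (a_seq : is_bin_sequence b A a) :
  (forall m, 0 < m -> exists! S : {fset nat}, legal_decomposition b A a m S) <->
  (forall n, [\/ A n = [fset 0; 1],
                 A n = [fset k in iota 0 (b n)]
               | A n = [fset k in iota 0 (b n).+1]]).
Proof.
have exact0 : exact (legal_upto b A (bin_start b 0)) a (a (bin_start b 0)).
  rewrite /bin_start big_ord0 a_seq.1.
  have S0 S : legal_upto b A 0 S -> S = fset0.
    by case=> _ SS; apply/fsetP => i; rewrite in_fset0; apply/negP => /SS.
  split=> [S /S0 ->|m|S S' /S0 -> /S0 ->] //; first by rewrite wsum0.
  rewrite ltnS leqn0 => /eqP ->; exists fset0; rewrite ?wsum0 //; split=> //.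
  exact: legal0.
split=> [H n|HA m m0]; last first.
  have ex n : exact (legal_upto b A (bin_start b n)) a (a (bin_start b n)).
    by elim: n => // n IH; exact: (exact_next_bin A_ge a_seq IH (HA n)).
  (* The first term of bin [n] is itself a legal sum below the next bound, so the bounds increase
     strictly and every [m] is eventually covered. *)
  have grow n : n < a (bin_start b n).
    elim: n => [|n IH]; first exact: (term_gt0 a_seq).
    have [lt _ _] := ex n.+1.
    have : wsum a [fset bin_start b n] < a (bin_start b n.+1).
      have bn := b_gt0 n.
      apply: lt; split=> [|i]; last by rewrite inE startS => /eqP ->; lia.
      apply/(@legal_bin b A A_ge n); rewrite ?cardfs1 ?A1 //.
      by apply/sub_blockP => i; rewrite inE => /eqP ->; lia.
    by rewrite wsum1; lia.
  have [lt exm un] := ex m; have [S [lS Sm] SE] := exm m (grow m).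
  exists S; split=> // S' [lS' SE'].
  (* The first [K] bins contain both sets: every bin is nonempty, and [wsum succn S'] exceeds every
     position in [S']. *)
  pose K := m + wsum succn S'.
  have [_ _ unK] := ex K.
  have mK : bin_start b m <= bin_start b K by apply: start_le; rewrite leq_addr.
  apply: unK; last by rewrite SE -SE'.
    by split=> // i /Sm; lia.
  split=> // i iS'; apply: leq_trans (start_ge b_gt0 K).
  by rewrite /K (wsumD1 succn i) iS'; lia.
have legal_ex m : exists2 S, legal b A S & wsum a S = m.
  have [->|/H[S [[lS SE] _]]] := posnP m; last by exists S.
  by exists fset0; [exact: legal0|rewrite wsum0].
have uniq S S' : legal b A S -> legal b A S' -> wsum a S = wsum a S' -> S = S'.
  move=> lS lS' E; have a0 := term_gt0 a_seq.
  have [S0|S0] := posnP (wsum a S).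
    by rewrite (wsum_eq0 a0 S0) (@wsum_eq0 _ S' a0) // -E.
  by have [S1 [_ u]] := H _ S0; rewrite -(u S) // -(u S') //; split.
(* Exactness and the shape of [A k] are obtained alternately, bin by bin. *)
suff step k : exact (legal_upto b A (bin_start b k)) a (a (bin_start b k)) ->
    [\/ A k = [fset 0; 1], A k = [fset i in iota 0 (b k)]
      | A k = [fset i in iota 0 (b k).+1]].
  apply: (step); elim: n => // n IH.
  exact: (exact_next_bin A_ge a_seq IH (step n IH)).
move=> ex; have bound i := @A_bound b A A_le k i.
have exP : exists i, i \notin A k.
  by exists (b k).+1; apply/negP => /bound; rewrite ltnn.
case: (ex_minnP exP) => t tA tmin.
have ltA i : i < t -> i \in A k.
  by rewrite ltnNge; apply: contraNT => /tmin.
have AE j : (forall i, j <= i -> i \notin A k) -> j <= t ->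
    A k = [fset i in iota 0 j].
  move=> jA jt; apply/fsetP => i; rewrite !inE mem_iota /= add0n.
  by have [ij|ij] := ltnP i j; [rewrite ltA //; lia|apply/negbTE/jA].
have t_le : t <= (b k).+1 by apply: tmin; apply/negP => /bound; rewrite ltnn.
have t_ge2 : 1 < t.
  by case: t tA {tmin ltA AE t_le} => [|[|//]]; rewrite ?A0 ?A1.
have [tb|tb] := leqP (b k) t.
  have [tE|tE] : t = (b k).+1 \/ t = b k by lia.
    apply: Or33; apply: AE; last by rewrite tE.
    by move=> i ib; apply/negP => /bound; lia.
  apply: Or32; apply: AE; last by rewrite tE.
  move=> i; rewrite leq_eqVlt => /orP[/eqP <-|ib]; first by rewrite -tE.
  by apply/negP => /bound; lia.
have [t3|t3] := ltnP 2 t; first by case: (initial_run_le2 b_gt0 A_ge a_seq ex uniq ltA tA t3 tb).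
have t2 : t = 2 by lia.
(* Either 2 is missing with nothing above it, or the least larger element is the [s] of the gap
   argument. *)
have [exs|nos] := boolp.pselect (exists i, (1 < i) && (i \in A k)); last first.
  have A2 i : 1 < i -> i \notin A k.
    by move=> i2; apply/negP => iA; apply: nos; exists i; rewrite i2.
  by apply: Or31; rewrite (AE 2 A2) ?t2 //; apply/fsetP => -[|[|i]]; rewrite !inE.
case: (ex_minnP exs) => s /andP[s1 sA] smin.
have s3 : 2 < s.
  by rewrite ltn_neqAle s1 andbT; apply: contraNneq tA => E; rewrite t2 E.
case: (gap_absurd b_gt0 A_ge A_le a_seq ex uniq s3 sA _ legal_ex).
move=> i /andP[i1 is_]; apply/negP => iA.
by have := smin i; rewrite i1 iA => /(_ isT); lia.
Qed.
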